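(* Let $X,Y\subset\mathbb{R}^n$ be closed convex sets with $S:=X\cap Y\neq\varnothing$. Let $T:\mathbb{R}^n\to\mathbb{R}^n$ be an admissible operator, let $(\alpha_k)_{k\ge 0}\subset(0,1)$ be an arbitrary sequence, let $z_0\in\mathbb{R}^n$, and let $(z_k)_{k\ge 0}$ be the ecCRM iterates $z_{k+1}=\mathrm{PCRM}\bigl(N^{\alpha_k}z_k\bigr)$, $k\ge 0$. Then $(z_k)$ is Fejér monotone with respect to $S$, i.e. $\|z_{k+1}-s\|\le\|z_k-s\|$ for all $s\in S$ and all $k\ge 0$, and $(z_k)$ converges to a point of $S$.
   Context: $\mathbb{R}^n$ carries the Euclidean inner product and norm. For a nonempty closed convex set $C$, $P_C$ is the metric projection onto $C$ and $R_C:=2P_C-\mathrm{Id}$ is the reflection. Circumcenter: for $z,v,w\in\mathbb{R}^n$, $\operatorname{circ}(z,v,w)$ is the point $c$ in the affine hull of $\{z,v,w\}$ with $\|c-z\|=\|c-v\|=\|c-w\|$; when it exists it is unique. Define $\mathrm{PCRM}(z):=\operatorname{circ}(z,R_X(z),R_Y(z))$. A point $z$ is centralized if $\langle z-P_Xz,\,z-P_Yz\rangle\le 0$. At centralized points the circumcenter defining $\mathrm{PCRM}(z)$ exists, and the points $N^{\alpha}z$ below are always centralized. Admissible operator: $T:\mathbb{R}^n\to\mathbb{R}^n$ is admissible if $T(\mathbb{R}^n)\subset Y$ and $\|Tz-s\|\le\|z-s\|$ for all $z\in\mathbb{R}^n$, $s\in S$. For $\alpha\in(0,1)$, $N^{\alpha}z:=\alpha\,Tz+(1-\alpha)\,P_X(Tz)$.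 *)

(* Defs.v *)
From mathcomp Require Import all_boot all_order all_algebra.
From mathcomp Require Import all_classical all_reals all_analysis.

Set Implicit Arguments.
Unset Strict Implicit.
Unset Printing Implicit Defensive.

Import Order.TTheory GRing.Theory Num.Theory.
Import numFieldNormedType.Exports.

Local Open Scope classical_set_scope.
Local Open Scope ring_scope.

Section Euclidean.
Context {R : realType} {n : nat}.
Implicit Types u v w z c : 'rV[R]_n.

Definition dotp u v : R := \sum_(i < n) u 0 i * v 0 i.

(* The library norm `|u| on 'rV[R]_n is the sup norm, hence a separate
   Euclidean norm; both induce the canonical (product) topology of 'rV[R]_n,
   so [closed] and [-->] on 'rV[R]_n have their usual meaning in R^n. *)
Definition enorm u : R := Num.sqrt (dotp u u).

Definition is_proj (C : set 'rV[R]_n) z p : Prop :=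
  C p /\ (forall y, C y -> enorm (z - p) <= enorm (z - y)).

(* [xget 0 A] is an element of [A], or 0 when [A] is empty. The metric
   projection onto a nonempty closed convex set exists and is unique. *)
Definition proj (C : set 'rV[R]_n) z : 'rV[R]_n := xget 0 [set p | is_proj C z p].

Definition reflection (C : set 'rV[R]_n) z : 'rV[R]_n := 2 *: proj C z - z.

Definition aff_hull3 z v w : set 'rV[R]_n :=
  [set c | exists a b d : R, a + b + d = 1 /\ c = a *: z + b *: v + d *: w].

Definition is_circ z v w c : Prop :=
  [/\ aff_hull3 z v w c,
      enorm (c - z) = enorm (c - v) & enorm (c - v) = enorm (c - w)].

(* 0 when there is no circumcenter, i.e. for three distinct collinear points *)
Definition circ z v w : 'rV[R]_n := xget 0 [set c | is_circ z v w c].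

Definition PCRM (X Y : set 'rV[R]_n) z : 'rV[R]_n :=
  circ z (reflection X z) (reflection Y z).

Definition admissible (X Y : set 'rV[R]_n) (T : 'rV[R]_n -> 'rV[R]_n) : Prop :=
  (forall z, Y (T z)) /\
  (forall z s, (X `&` Y) s -> enorm (T z - s) <= enorm (z - s)).

(* N^alpha z *)
Definition Nop (X : set 'rV[R]_n) (T : 'rV[R]_n -> 'rV[R]_n) (alpha : R) z :
    'rV[R]_n :=
  alpha *: T z + (1 - alpha) *: proj X (T z).

Definition Fejer_monotone (S : set 'rV[R]_n) (z : nat -> 'rV[R]_n) : Prop :=
  forall s, S s -> forall k, enorm (z k.+1 - s) <= enorm (z k - s).

End Euclidean.

(* Main.v *)
(* The decrease of the squared distance to s in S during one step is at least
   |y - x|^2, where y = T z_k and x = P_X y, whatever alpha_k is.  At the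
   centralized point w = N^alpha z_k, PCRM(w) = w - l (w - P_X w) - m (w - P_Y w)
   with l, m >= 0 is the projection of w onto the intersection of the half-spaces
   through P_X w and P_Y w that contain X and Y; hence
   |PCRM(w) - s|^2 + |PCRM(w) - w|^2 <= |w - s|^2 and |PCRM(w) - w| >= |w - P_X w|.
   So x, y and z_{k+1} get arbitrarily close to each other, every cluster point
   of (z_k) lies in S, and Fejer monotonicity turns a cluster point into a limit. *)
Require Import Defs.
From mathcomp Require Import all_boot all_order all_algebra.
From mathcomp Require Import all_classical all_reals all_analysis.
From mathcomp Require Import ring lra.
Import Order.TTheory GRing.Theory Num.Theory.
Import numFieldNormedType.Exports.
Local Open Scope classical_set_scope.
Local Open Scope ring_scope.

(* [proj] alone refers to a later import, not to the metric projection. *)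
Local Notation proj := Defs.proj.

(** * Euclidean inner product and squared norm *)

Section EuclideanSpace.
Context {R : realType} {n : nat}.
Implicit Types (u v w z p q s c : 'rV[R]_n) (C X Y : set 'rV[R]_n).

Lemma dotpC u v : dotp u v = dotp v u.
Proof. by apply: eq_bigr => i _; rewrite mulrC. Qed.

Lemma dotpDl u v w : dotp (u + v) w = dotp u w + dotp v w.
Proof.
by rewrite /dotp -big_split; apply: eq_bigr => i _; rewrite mxE mulrDl.
Qed.

Lemma dotpZl (a : R) u v : dotp (a *: u) v = a * dotp u v.
Proof.
by rewrite /dotp mulr_sumr; apply: eq_bigr => i _; rewrite mxE mulrA.
Qed.

Lemma dotpNl u v : dotp (- u) v = - dotp u v.
Proof. by rewrite -scaleN1r dotpZl mulN1r. Qed.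

Lemma dotpDr u v w : dotp u (v + w) = dotp u v + dotp u w.
Proof. by rewrite dotpC dotpDl !(dotpC u). Qed.

Lemma dotpZr (a : R) u v : dotp u (a *: v) = a * dotp u v.
Proof. by rewrite dotpC dotpZl (dotpC u). Qed.

Lemma dotpNr u v : dotp u (- v) = - dotp u v.
Proof. by rewrite dotpC dotpNl (dotpC u). Qed.

Definition dotp_linE := (dotpDl, dotpDr, dotpZl, dotpZr, dotpNl, dotpNr).

Lemma dotp_ge0 u : 0 <= dotp u u.
Proof. by apply: sumr_ge0 => i _; rewrite -expr2 sqr_ge0. Qed.

Lemma sqr_coord_le_dotp u i : u 0 i ^+ 2 <= dotp u u.
Proof.
rewrite /dotp (bigD1 i) //= -expr2 lerDl.
by apply: sumr_ge0 => j _; rewrite -expr2 sqr_ge0.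
Qed.

Lemma dotp_eq0 u : dotp u u <= 0 -> u = 0.
Proof.
move=> u0; apply/rowP => i; rewrite mxE; apply/eqP.
rewrite -sqrf_eq0 eq_le sqr_ge0 andbT.
exact: le_trans (sqr_coord_le_dotp u i) u0.
Qed.

Lemma dotp_subC u v : dotp (u - v) (u - v) = dotp (v - u) (v - u).
Proof. by rewrite -opprB dotpNl dotpNr opprK. Qed.

(** Parallelogram law with [|u - v|^2] dropped; it replaces the triangle inequality, so that only
    squared norms occur. *)
Lemma dotpD_le u v : dotp (u + v) (u + v) <= 2 * dotp u u + 2 * dotp v v.
Proof.
have := dotp_ge0 (u - v).
by rewrite !dotp_linE (dotpC v u); lra.
Qed.

Lemma sqnormBZ u v (t : R) :
  dotp (u - t *: v) (u - t *: v) = dotp u u - 2 * t * dotp u v + t ^+ 2 * dotp v v.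
Proof. by rewrite !dotp_linE (dotpC v u); ring. Qed.

Lemma enorm_le u v : (enorm u <= enorm v) = (dotp u u <= dotp v v).
Proof. by rewrite ler_sqrt // dotp_ge0. Qed.

Lemma enorm_eq u v : enorm u = enorm v <-> dotp u u = dotp v v.
Proof.
split=> [/eqP|e]; last by rewrite /enorm e.
by rewrite eqr_sqrt ?dotp_ge0 // => /eqP.
Qed.

(** * Topology of R^n through squared Euclidean distances *)

Lemma sqdist_continuous p : continuous (fun q => dotp (p - q) (p - q)).
Proof.
apply: continuous_big => [|i _ q]; first exact: add_continuous.
have cont : {for q, continuous (fun t : 'rV[R]_n => (p - t) 0 i)}.
  have -> : (fun t : 'rV[R]_n => (p - t) 0 i) = (fun t => p 0 i - t 0 i).
    by apply/funext => t; rewrite !mxE.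
  have h : {for q, continuous (fun t : 'rV[R]_n => t 0 i)}.
    exact: coord_continuous.
  have h0 : {for q, continuous (fun t : 'rV[R]_n => p 0 i)}.
    exact: cst_continuous.
  exact: (continuousB h0 h).
exact: (continuousM cont cont).
Qed.

(** A sup-norm ball of radius e contains the Euclidean one, as each squared coordinate is at most
    the squared norm; the converse is continuity of the squared distance. *)
Lemma nbhs_sqdist p (A : set 'rV[R]_n) :
  nbhs p A <-> exists2 e : R, 0 < e & forall q, dotp (p - q) (p - q) < e -> A q.
Proof.
split=> [/nbhs_ballP[e /= e0 pA]|[e e0 pA]].
  exists (e ^+ 2); first exact: exprn_gt0.
  move=> q pq; apply: pA; split=> // i j; rewrite /ball /= (ord1 i).
  rewrite -(ltr_pXn2r (n := 2)) ?nnegrE ?(ltW e0) // real_normK ?num_real //.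
  apply: le_lt_trans pq; have := sqr_coord_le_dotp (p - q) j.
  by rewrite mxE [(- q) 0 j]mxE.
have /(_ (fun r => r < e)) := @sqdist_continuous p p.
rewrite /= subrr => H; apply: filterS pA _; apply: H.
by apply: lt_nbhsl; rewrite -(scale0r p) dotpZl mul0r.
Qed.

Lemma closed_ball_compact p (r : R) : compact [set q | dotp (p - q) (p - q) <= r].
Proof.
have clB : closed [set q | dotp (p - q) (p - q) <= r].
  have cl : closed [set x : R | x <= r] by exact: closed_le.
  by apply: (preimage_closed _ cl) => q _; exact: sqdist_continuous.
(* The half-width [1 + r] avoids a square root: [d^2 <= r] gives [2|d| <= 1 + d^2 <= 1 + r]. *)
pose A (i : 'I_n) : set R := `[p 0 i - (1 + r), p 0 i + (1 + r)]%classic.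
have cA : compact [set v : 'rV[R]_n | forall i, A i (v ord0 i)].
  by apply: rV_compact => i; exact: segment_compact.
rewrite -(_ : [set v : 'rV[R]_n | forall i, A i (v ord0 i)] `&`
   [set q | dotp (p - q) (p - q) <= r] = [set q | dotp (p - q) (p - q) <= r]).
  exact: compact_closedI.
apply/setIidr => q /= qr i; rewrite /A /= in_itv /=.
have := le_trans (sqr_coord_le_dotp (p - q) i) qr.
rewrite !mxE; set d := p 0 i - q ord0 i => dr.
have := sqr_ge0 d; have := sqr_ge0 (d - 1); have := sqr_ge0 (d + 1).
by rewrite sqrrB sqrrD /d in dr * => *; apply/andP; split; lra.
Qed.

(** * Metric projection onto a closed convex set *)

Lemma convex_setD C : convex_set C -> forall x y (t : R), C x -> C y ->
  0 <= t <= 1 -> C (t *: x + (1 - t) *: y).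
Proof.
move=> cC x y t Cx Cy /andP[t0 t1].
have /= := cC x y (Itv01 t0 t1) (mem_set Cx) (mem_set Cy).
by rewrite inE.
Qed.

Lemma is_proj_ex C z : closed C -> C !=set0 -> exists p, is_proj C z p.
Proof.
move=> clC [c0 Cc0].
(* Cutting C by the ball around z through [c0] makes it compact; points of C outside are farther
   from z than [c0]. *)
pose K : set 'rV[R]_n :=
  [set q | dotp (z - q) (z - q) <= dotp (z - c0) (z - c0)] `&` C.
have [||p] := @EVT_min_rV R n (fun q => dotp (z - q) (z - q)) K _
    (compact_closedI (@closed_ball_compact _ _) clC).
- by exists c0; exact: (conj (lexx _) Cc0).
- by apply: continuous_subspaceT => q; exact: sqdist_continuous.
- rewrite inE => -[pc0 Cp] pmin; exists p; split=> // y Cy.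
  rewrite enorm_le.
  have [yc0|/ltW cy0] := leP (dotp (z - y) (z - y)) (dotp (z - c0) (z - c0)).
    by apply: pmin; rewrite inE.
  exact: le_trans pc0 cy0.
Qed.

Lemma is_proj_obtuse C z p : convex_set C -> is_proj C z p ->
  forall y, C y -> dotp (z - p) (y - p) <= 0.
Proof.
move=> cC [Cp pmin] y Cy; rewrite leNgt; apply/negP.
set g := dotp _ _ => g0.
have B0 : 0 <= dotp (y - p) (y - p) := dotp_ge0 _.
set B := dotp (y - p) _ in B0.
have gB0 : 0 < g + B by lra.
(* Minimality of p against the point at parameter t gives [2 g <= t B], whereas this t satisfies
   [t B = g - t g < g]. *)
pose t := g / (g + B).
have tE : t * (g + B) = g by rewrite /t divfK // gt_eqF.
have t0 : 0 < t by exact: divr_gt0.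
have t1 : t <= 1 by rewrite ler_pdivrMr //; lra.
have := pmin _ (convex_setD C cC y p t Cy Cp _).
rewrite (ltW t0) t1 enorm_le => /(_ isT).
have -> : z - (t *: y + (1 - t) *: p) = (z - p) - t *: (y - p).
  by apply/rowP => i; rewrite !mxE; ring.
rewrite sqnormBZ -/B -/g => h.
have : 0 <= t * (t * B - 2 * g) by lra.
rewrite pmulr_rge0 //; have : 0 < t * g by exact: mulr_gt0.
by lra.
Qed.

Lemma proj_spec C z : closed C -> convex_set C -> C !=set0 ->
  C (proj C z) /\ forall y, C y -> dotp (z - proj C z) (y - proj C z) <= 0.
Proof.
move=> clC cC C0.
have pP : is_proj C z (proj C z).
  by apply: (@xgetPex _ 0 [set p | is_proj C z p]); exact: (is_proj_ex C z clC C0).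
by split; [case: pP|exact: is_proj_obtuse].
Qed.

(** The obtuse-angle inequalities at p and at [q = proj C z], each tested on the other point, add up
    to [|q - p|^2 <= 0]. *)
Lemma proj_eq C z p : closed C -> convex_set C -> C p ->
  (forall y, C y -> dotp (z - p) (y - p) <= 0) -> proj C z = p.
Proof.
move=> clC cC Cp hp.
have [Cq hq] := proj_spec C z clC cC (ex_intro _ p Cp).
have := hp _ Cq; have := hq _ Cp; set q := proj C z => h1 h2.
apply/eqP; rewrite -subr_eq0; apply/eqP/dotp_eq0.
have -> : q - p = (z - p) - (z - q) by apply/rowP => i; rewrite !mxE; ring.
rewrite dotpDl dotpNl.
have e : forall a b c : 'rV[R]_n, a - b - (a - c) = c - b.
  by move=> a b c; apply/rowP => i; rewrite !mxE; ring.
rewrite e; move: h1; rewrite -(opprB q p) dotpNr; lra.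
Qed.

End EuclideanSpace.

(** * Circumcenter of a point and its two reflections *)

Section Circumcenter.
Context {R : realType} {n : nat}.
Implicit Types (u v w z p q s c : 'rV[R]_n) (C X Y : set 'rV[R]_n).

(** For [h = l u + m v] the hypotheses read [<h, u> = |u|^2] and [<h, v> = |v|^2], and
    [<h, t> = |t|^2] is exactly [|h| = |h - 2 t|]. *)
Lemma is_circ_reflections w u v (l m : R) :
  l * dotp u u + m * dotp u v = dotp u u ->
  l * dotp u v + m * dotp v v = dotp v v ->
  is_circ w (w - 2 *: u) (w - 2 *: v) (w - l *: u - m *: v).
Proof.
move=> eu ev.
have eqdist t : dotp (l *: u + m *: v) t = dotp t t ->
    enorm (w - l *: u - m *: v - w) =
    enorm (w - l *: u - m *: v - (w - 2 *: t)).
  move=> et; apply/enorm_eq.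
  have -> : w - l *: u - m *: v - w = - (l *: u + m *: v).
    by apply/rowP => i; rewrite !mxE; ring.
  have -> : w - l *: u - m *: v - (w - 2 *: t) = 2 *: t - (l *: u + m *: v).
    by apply/rowP => i; rewrite !mxE; ring.
  rewrite -(opprB _ (2 *: t)) !(dotpNl, dotpNr) !opprK sqnormBZ et; ring.
have eu' := eqdist u; have ev' := eqdist v.
split.
- exists (1 - l / 2 - m / 2), (l / 2), (m / 2); split; first by field.
  by apply/rowP => i; rewrite !mxE; field.
- by apply: eu'; rewrite !dotp_linE (dotpC v u).
- rewrite -eu' -?ev' //; first by rewrite !dotp_linE.
  by rewrite !dotp_linE (dotpC v u).
Qed.

(** Equidistance fixes the inner products of [c - w] with u and v, so [c - c'] is orthogonal to
    both; it also lies in their span. *)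
Lemma is_circ_reflections_uniq w u v (c c' : 'rV[R]_n) :
  is_circ w (w - 2 *: u) (w - 2 *: v) c ->
  is_circ w (w - 2 *: u) (w - 2 *: v) c' -> c = c'.
Proof.
have ortho t e : enorm (e - w) = enorm (e - (w - 2 *: t)) ->
    dotp (e - w) t = - dotp t t.
  move/enorm_eq.
  have -> : e - (w - 2 *: t) = (e - w) - (-2) *: t.
    by apply/rowP => i; rewrite !mxE; ring.
  rewrite sqnormBZ; lra.
move=> [[a [b [d [e1 ce]]] h1 h2]] [[a' [b' [d' [e1' ce']]] h1' h2']].
have cu : dotp (c - c') u = 0.
  have -> : c - c' = (c - w) - (c' - w) by apply/rowP => i; rewrite !mxE; ring.
  by rewrite dotpDl dotpNl !ortho // subrr.
have cv : dotp (c - c') v = 0.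
  have -> : c - c' = (c - w) - (c' - w) by apply/rowP => i; rewrite !mxE; ring.
  by rewrite dotpDl dotpNl !ortho ?subrr // ?h1' ?h1.
have cE : c - c' = (-2 * (b - b')) *: u + (-2 * (d - d')) *: v.
  rewrite ce ce'.
  have -> : a = 1 - b - d by lra.
  have -> : a' = 1 - b' - d' by lra.
  by apply/rowP => i; rewrite !mxE; ring.
apply/eqP; rewrite -subr_eq0; apply/eqP/dotp_eq0.
by rewrite {2}cE dotpDr !dotpZr cu cv; lra.
Qed.

(* If [u] and [v] are both nonzero, they cannot be antiparallel: the two
   half-spaces [<. - w, u> <= - |u|^2], [<. - w, v> <= - |v|^2] share [s]. *)
Lemma circ_coefs u v (d : 'rV[R]_n) : dotp u v <= 0 ->
  dotp d u <= - dotp u u -> dotp d v <= - dotp v v ->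
  exists l m : R, [/\ 0 <= l, 0 <= m,
    l * dotp u u + m * dotp u v = dotp u u &
    l * dotp u v + m * dotp v v = dotp v v].
Proof.
move=> g0 du dv.
have [u0|uN0] := eqVneq u 0.
  exists 0, 1; rewrite u0 -(scale0r v) !dotpZl; split; lra.
have [v0|vN0] := eqVneq v 0.
  exists 1, 0; rewrite v0 -(scale0r u) !(dotpZl, dotpZr); split; lra.
have A0 : 0 < dotp u u.
  by rewrite ltNge; apply: contra uN0 => /dotp_eq0 ->.
have B0 : 0 < dotp v v.
  by rewrite ltNge; apply: contra vN0 => /dotp_eq0 ->.
(* Otherwise pairing with d gives [B x = g y], where [x = <d, u>] and [y = <d, v>]; but [B x < 0],
   while g and y are both nonpositive. *)
have t0 : dotp v v *: u - dotp u v *: v != 0.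
  apply/negP => /eqP t0.
  have := congr1 (dotp d) t0.
  rewrite -(scale0r u) dotpDr dotpNr !dotpZr mul0r.
  set A := dotp u u in du A0 *; set B := dotp v v in dv B0 *.
  set g := dotp u v in g0 *; set x := dotp d u in du *; set y := dotp d v in dv *.
  move=> e; have : B * (- x) > 0 by apply: mulr_gt0 => //; lra.
  have : - g * (- y) >= 0 by apply: mulr_ge0; lra.
  lra.
have : 0 < dotp (dotp v v *: u - dotp u v *: v) (dotp v v *: u - dotp u v *: v).
  by rewrite ltNge; apply: contra t0 => /dotp_eq0 ->.
rewrite sqnormBZ !dotp_linE.
set A := dotp u u in du A0 *; set B := dotp v v in dv B0 *.
set g := dotp u v in g0 *.
have -> : B * (B * A) - 2 * g * (B * g) + g ^+ 2 * B = B * (A * B - g ^+ 2) by ring.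
rewrite pmulr_rgt0 // => D0.
have D1 : A * B - g ^+ 2 != 0 by rewrite gt_eqF.
(* Cramer's rule for the Gram system; [g <= 0] makes both numerators nonnegative. *)
exists ((A * B - g * B) / (A * B - g ^+ 2)), ((A * B - g * A) / (A * B - g ^+ 2)).
have gA : 0 <= - g * A by apply: mulr_ge0; lra.
have gB : 0 <= - g * B by apply: mulr_ge0; lra.
have AB : 0 < A * B by exact: mulr_gt0.
split; [apply: divr_ge0; lra|apply: divr_ge0; lra|by field|by field].
Qed.

(** Let [h = l u + m v = w - PCRM(w)]. Weighting the half-space inequalities at s by [l, m >= 0]
    gives [<s - w, h> <= -|h|^2], which is the first bound. *)
Lemma PCRM_firm X Y w s : closed X -> closed Y -> convex_set X -> convex_set Y ->
  (X `&` Y) s -> dotp (w - proj X w) (w - proj Y w) <= 0 ->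
  dotp (PCRM X Y w - s) (PCRM X Y w - s) + dotp (PCRM X Y w - w) (PCRM X Y w - w)
    <= dotp (w - s) (w - s) /\
  dotp (w - proj X w) (w - proj X w) <= dotp (PCRM X Y w - w) (PCRM X Y w - w).
Proof.
move=> clX clY cX cY [Xs Ys] wc.
have [_ /(_ _ Xs) hu] := proj_spec X w clX cX (ex_intro _ s Xs).
have [_ /(_ _ Ys) hv] := proj_spec Y w clY cY (ex_intro _ s Ys).
rewrite /PCRM /reflection.
have reflE C : 2 *: proj C w - w = w - 2 *: (w - proj C w).
  by apply/rowP => i; rewrite !mxE; ring.
rewrite !reflE.
set u := w - proj X w in wc hu *; set v := w - proj Y w in wc hv *.
have du : dotp (s - w) u <= - dotp u u.
  have e : s - proj X w = (s - w) + u by rewrite /u addrA subrK.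
  by move: hu; rewrite e dotpDr (dotpC u (s - w)); lra.
have dv : dotp (s - w) v <= - dotp v v.
  have e : s - proj Y w = (s - w) + v by rewrite /v addrA subrK.
  by move: hv; rewrite e dotpDr (dotpC v (s - w)); lra.
clearbody u v => {hu hv}.
have [l [m [l0 m0 eu ev]]] := circ_coefs u v (s - w) wc du dv.
have hc := is_circ_reflections w u v l m eu ev.
have -> : circ w (w - 2 *: u) (w - 2 *: v) = w - l *: u - m *: v.
  apply: xget_unique => // c' hc'; exact: is_circ_reflections_uniq hc' hc.
set h := l *: u + m *: v.
have -> : w - l *: u - m *: v - w = - h by apply/rowP => i; rewrite !mxE; ring.
have -> : w - l *: u - m *: v - s = - (s - w) - 1 *: h.
  by apply/rowP => i; rewrite !mxE; ring.
have -> : w - s = - (s - w) by rewrite opprB.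
rewrite sqnormBZ !(dotpNl, dotpNr) !opprK.
have hu' : dotp h u = dotp u u by rewrite -[RHS]eu /h !dotp_linE (dotpC v u).
have hh : dotp h h = l * dotp u u + m * dotp v v.
  by rewrite {2}/h !dotpDr !dotpZr hu' -ev /h !dotp_linE.
have sh : dotp (s - w) h = l * dotp (s - w) u + m * dotp (s - w) v.
  by rewrite /h dotpDr !dotpZr.
have : l * (dotp (s - w) u + dotp u u) <= 0 by apply: mulr_ge0_le0; lra.
have : m * (dotp (s - w) v + dotp v v) <= 0 by apply: mulr_ge0_le0; lra.
split; first lra.
(* Since [<h, u> = |u|^2], [|h - u|^2 >= 0] says [|u|^2 <= |h|^2]. *)
have := dotp_ge0 (h - 1 *: u); rewrite sqnormBZ hu'; lra.
Qed.

End Circumcenter.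

(** * One ecCRM step *)

Section Iteration.
Context {R : realType} {n : nat}.
Implicit Types (w x y s p : 'rV[R]_n) (C X Y S : set 'rV[R]_n).
Implicit Types (z : nat -> 'rV[R]_n).

(* The bound does not involve [a]: the decrease [(1 - a^2) |y - x|^2] of
   [Nop] and the decrease [a^2 |y - x|^2] of [PCRM] add up to [|y - x|^2]. *)
Lemma ecCRM_step X Y (T : 'rV[R]_n -> 'rV[R]_n) (a : R) p s :
  let p' := PCRM X Y (Nop X T a p) in
  let d := dotp (p - s) (p - s) - dotp (p' - s) (p' - s) in
  closed X -> closed Y -> convex_set X -> convex_set Y ->
  admissible X Y T -> 0 < a < 1 -> (X `&` Y) s ->
  exists x y, [/\ X x, Y y, dotp (p' - x) (p' - x) <= 4 * d &
    dotp (p' - y) (p' - y) <= 4 * d].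
Proof.
move=> p' d clX clY cX cY [TY Tle] /andP[a0 a1] Ss; have [Xs Ys] := Ss.
have yb := Tle p s Ss; rewrite enorm_le in yb.
have Yy := TY p.
rewrite /d /p' /Nop {d p'}; set y := T p in yb Yy *.
have [Xx hx] := proj_spec X y clX cX (ex_intro _ s Xs).
set x := proj X y in Xx hx *; set w := a *: y + (1 - a) *: x.
set p' := PCRM X Y w; exists x, y.
have wx : w - x = a *: (y - x) by apply/rowP => i; rewrite !mxE; ring.
have wy : w - y = - (1 - a) *: (y - x) by apply/rowP => i; rewrite !mxE; ring.
have ws : w - s = (y - s) - (1 - a) *: (y - x).
  by apply/rowP => i; rewrite !mxE; ring.
(* The whole segment from x to y projects onto x, because [w - x] is a nonnegative multiple of
   [y - x]. *)
have projw : proj X w = x.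
  apply: proj_eq => // t Xt; rewrite wx dotpZl.
  by apply: mulr_ge0_le0; [exact: ltW|exact: hx].
(* The obtuse angle at [q = P_Y w], tested on y, reads [|w - q|^2 + (1 - a) <w - q, y - x> <= 0];
   dividing by [1 - a > 0] shows that w is centralized. *)
have wc : dotp (w - proj X w) (w - proj Y w) <= 0.
  have [_ /(_ _ Yy)] := proj_spec Y w clY cY (ex_intro _ s Ys).
  set q := proj Y w.
  have -> : y - q = (w - q) - (w - y) by apply/rowP => i; rewrite !mxE; ring.
  rewrite wy projw wx dotpDr dotpNr dotpZr dotpZl (dotpC (y - x)) => h.
  have h0 := dotp_ge0 (w - q).
  have : (1 - a) * dotp (w - q) (y - x) <= 0 by lra.
  rewrite pmulr_rle0; last lra.
  by move=> ?; apply: mulr_ge0_le0 => //; exact: ltW.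
have := PCRM_firm X Y w s clX clY cX cY Ss wc; rewrite -/p' projw => -[].
have := hx s Xs.
have -> : s - x = (y - x) - (y - s) by apply/rowP => i; rewrite !mxE; ring.
rewrite dotpDr dotpNr wx ws sqnormBZ (dotpC (y - x) (y - s)) dotpZl dotpZr.
have p'x : p' - x = (p' - w) + (w - x) by rewrite addrA subrK.
have p'y : p' - y = (p' - w) + (w - y) by rewrite addrA subrK.
have := dotpD_le (p' - w) (w - x); have := dotpD_le (p' - w) (w - y).
rewrite -p'x -p'y wx wy !dotpZl !dotpZr.
have := dotp_ge0 (y - x).
move: yb.
set Ps := dotp (p - s) _; set P's := dotp (p' - s) _; set P'w := dotp (p' - w) _.
set e := dotp (y - x) _.
set b := dotp (y - s) (y - s); set g := dotp (y - s) (y - x).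
move=> bPs e0 hy hx' eg h1 h2.
(* From [e <= g] and [b <= Ps], [h1] yields [P'w + (1 - a^2) e <= Ps - P's]. The squared distances
   to x and y are at most [2 P'w + 2 a^2 e] and [2 P'w + 2 (1 - a)^2 e]; [a^2 e <= P'w] and
   [(1 - a)^2 <= 1 - a^2] then give the factor 4. *)
have ae : a * e <= e by rewrite -[leRHS]mul1r ler_wpM2r //; lra.
have ae0 : 0 <= a * e by apply: mulr_ge0 => //; lra.
have aae : a * (a * e) <= a * e by rewrite -[leRHS]mul1r ler_wpM2r //; lra.
have : 0 <= (1 - a) * (g - e) by apply: mulr_ge0; lra.
by split=> //; lra.
Qed.

(** * Vanishing decrements, cluster points and Fejér monotonicity *)

Lemma nonincreasing_gap (u : nat -> R) : (forall k, u k.+1 <= u k) ->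
  (forall k, 0 <= u k) ->
  forall e : R, 0 < e -> \forall k \near \oo, u k - u k.+1 < e.
Proof.
move=> udec u0 e e0.
have cu : u @ \oo --> inf (range u).
  apply: nonincreasing_cvgn; first exact/nonincreasing_seqP.
  by exists 0 => _ [k _ <-].
have cuS : (fun k => u k.+1) @ \oo --> inf (range u).
  by have := cu; rewrite -(cvg_shiftS u).
have c0 : (fun k => u k - u k.+1) @ \oo --> (0 : R).
  by rewrite -(subrr (inf (range u))); exact: cvgB cu cuS.
by have := c0 _ (lt_nbhsl e0).
Qed.

Lemma closed_cluster C z p : closed C -> cluster (z @ \oo) p ->
  (forall e : R, 0 < e -> \forall k \near \oo,
    exists2 x, C x & dotp (z k - x) (z k - x) < e) -> C p.
Proof.
move=> clC zp zC; apply: clC => B /nbhs_sqdist[e e0 eB].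
(* [dotpD_le] doubles each of two squared distances, hence a quarter of e for each. *)
have e40 : 0 < e / 4 by lra.
pose A := [set q | exists2 x, C x & dotp (q - x) (q - x) < e / 4].
have zA : (z @ \oo) A by exact: zC.
have pB : nbhs p [set q | dotp (p - q) (p - q) < e / 4].
  by apply/nbhs_sqdist; exists (e / 4).
have [q [[x Cx qx] /= pq]] := zp _ _ zA pB.
exists x; split=> //; apply: eB.
have -> : p - x = (p - q) + (q - x) by rewrite addrA subrK.
by apply: le_lt_trans (dotpD_le _ _) _; lra.
Qed.

(** As p itself is in S, the distance to p never increases: once an iterate enters a ball around p,
    all later ones stay there. *)
Lemma Fejer_cluster_cvg S z p : Fejer_monotone S z -> S p ->
  cluster (z @ \oo) p -> z k @[k --> \oo] --> p.
Proof.
move=> zF Sp zp B /nbhs_sqdist[e e0 eB].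
have pE : nbhs p [set q | dotp (p - q) (p - q) < e].
  by apply/nbhs_sqdist; exists e.
(* Clustering only provides a point; intersecting with the range of z turns it into an index N. *)
have zT : \forall k \near \oo, range z (z k) by apply: nearW => k; exists k.
have [_ [[N _ <-] /= zN]] := zp _ _ zT pE.
exists N => // k /= Nk; apply: eB; move: Nk.
elim: k => [|k IH]; first by rewrite leqn0 => /eqP N0; move: zN; rewrite N0.
rewrite leq_eqVlt => /predU1P[Nk|/IH]; first by move: zN; rewrite Nk.
apply: le_lt_trans.
by have := zF _ Sp k; rewrite enorm_le 2!(dotp_subC p).
Qed.

Lemma Fejer_cluster_ex S z : Fejer_monotone S z -> S !=set0 ->
  exists p, cluster (z @ \oo) p.
Proof.
move=> zF [s Ss].
have zB : \forall k \near \oo,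
    dotp (s - z k) (s - z k) <= dotp (s - z 0%N) (s - z 0%N).
  apply: nearW; elim=> [|k IH] //=; apply: le_trans IH.
  by have := zF _ Ss k; rewrite enorm_le 2!(dotp_subC s).
by have [p [_ zp]] := closed_ball_compact s _ (z @ \oo) _ zB; exists p.
Qed.

End Iteration.

Theorem theorem3p3 (R : realType) (n : nat) (X Y : set 'rV[R]_n)
    (hXclosed : closed X) (hYclosed : closed Y)
    (hXconvex : convex_set X) (hYconvex : convex_set Y)
    (hS : X `&` Y !=set0)
    (T : 'rV[R]_n -> 'rV[R]_n) (hT : admissible X Y T)
    (alpha : nat -> R) (halpha : forall k, 0 < alpha k < 1)
    (z0 : 'rV[R]_n) (z : nat -> 'rV[R]_n)
    (hz0 : z 0%N = z0)
    (hz : forall k, z k.+1 = PCRM X Y (Nop X T (alpha k) (z k))) :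
  Fejer_monotone (X `&` Y) z /\
  (exists2 x, (X `&` Y) x & z k @[k --> \oo] --> x).
Proof.
pose gap s k := dotp (z k - s) (z k - s) - dotp (z k.+1 - s) (z k.+1 - s).
have step k s : (X `&` Y) s -> exists x y, [/\ X x, Y y,
    dotp (z k.+1 - x) (z k.+1 - x) <= 4 * gap s k &
    dotp (z k.+1 - y) (z k.+1 - y) <= 4 * gap s k].
  by move=> Ss; rewrite /gap hz; exact: ecCRM_step.
(* Four times the gap bounds a squared norm, so the gap is nonnegative. *)
have zF : Fejer_monotone (X `&` Y) z.
  move=> s Ss k; rewrite enorm_le -subr_ge0 -/(gap s k).
  have [x [y [_ _ hx _]]] := step k s Ss.
  by have := dotp_ge0 (z k.+1 - x); lra.
split=> //; have [s Ss] := hS.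
have gap0 (e : R) : 0 < e -> \forall k \near \oo, 4 * gap s k < e.
  move=> e0; have e40 : 0 < e / 4 by lra.
  have H : \forall k \near \oo, gap s k < e / 4.
    apply: (@nonincreasing_gap _ (fun k => dotp (z k - s) (z k - s))) => // k.
      by have := zF s Ss k; rewrite enorm_le.
    exact: dotp_ge0.
  by apply: filterS H => k; lra.
have [p zp] := Fejer_cluster_ex _ _ zF hS.
have Sp : (X `&` Y) p.
  (* [step k] controls [z k.+1], hence the threshold [N.+1], which excludes index 0. The gap is
     measured from the fixed s, not from p, whose membership in S is being proved. *)
  split; (apply: closed_cluster zp _ => //) => e /gap0[N _ hN];
    exists N.+1 => // -[//|k] /= Nk; have hk := hN k Nk;
    have [x [y [Xx Yy hx hy]]] := step k s Ss.
  - by exists x => //; exact: le_lt_trans hx hk.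
  - by exists y => //; exact: le_lt_trans hy hk.
by exists p => //; exact: Fejer_cluster_cvg zF Sp zp.
Qed.
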